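(* Let $B$ be a left cancellative left semi-brace. Then $G=\mathrm{Ker}(\lambda_{|_E})$ if and only if $B$ is isomorphic to a semidirect product of left semi-braces $A\rtimes T$ of a skew left brace $A$ by a trivial left semi-brace $T$.
   Context: A left semi-brace is a triple $(B,+,\circ)$ where $(B,+)$ is a semigroup, $(B,\circ)$ is a group and $a\circ(b+c)=a\circ b+a\circ(a^-+c)$ for all $a,b,c\in B$, where $a^-$ is the inverse of $a$ in $(B,\circ)$ and $\circ$ has higher precedence than $+$. It is left cancellative if $(B,+)$ is left cancellative. The neutral element of $(B,\circ)$ is denoted by $0$. A skew left brace is a left semi-brace for which $(B,+)$ is a (not necessarily abelian) group. The trivial left semi-brace on a group $(E,\circ)$ is given by $a+b:=b$ for all $a,b$. Isomorphisms and automorphisms are bijections preserving both operations. For a left cancellative left semi-brace $B$: $G:=B+0=\{b+0\mid b\in B\}$ is a subgroup of $(B,\circ)$ and $(G,+,\circ)$ is a skew left brace; $E$ is the set of idempotents of $(B,+)$, it is a subgroup of $(B,\circ)$ and $(E,+,\circ)$ is a trivial left semi-brace; every element of $B$ is uniquely $g+e$ with $g\in G$, $e\in E$. For $a,b\in B$ put $\lambda_a(b):=a\circ(a^-+b)$; then $a\mapsto\lambda_a$ is a homomorphism $(B,\circ)\to\mathrm{Aut}(B,+)$ and $\lambda_a(E)=E$ for all $a$. Write $\lambda_{|_E}:(B,\circ)\to\mathrm{Aut}(E,+)$, $a\mapsto\lambda_a|_E$, for the induced action on $E$, and $\mathrm{Ker}(\lambda_{|_E})$ for its kernel. Semidirect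 product: for left cancellative left semi-braces $B_1,B_2$ and a homomorphism $\alpha$ from $(B_2,\circ)$ to $\mathrm{Aut}(B_1,+,\circ)$, $B_1\rtimes_\alpha B_2$ is the set $B_1\times B_2$ with $(b_1,c_1)+(b_2,c_2):=(b_1+b_2,c_1+c_2)$ and $(b_1,c_1)\circ(b_2,c_2):=(b_1\circ\alpha_{c_1}(b_2),c_1\circ c_2)$; it is a left cancellative left semi-brace. *)

(* Defs.v *)
From HB Require Import structures.
From mathcomp Require Import all_boot.
From mathcomp Require Import classical_sets.

Set Implicit Arguments.
Unset Strict Implicit.
Unset Printing Implicit Defensive.

Declare Scope brace_scope.
Local Open Scope classical_set_scope.
Local Open Scope group_scope.

(* A left semi-brace (B, +, o).  The group (B, o) is the multiplicative
   [groupType] structure of B: o is written [*], a^- is [a^-1], and the neutral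
   element (often denoted 0 in the literature) is [1].  As for every groupType
   the carrier is a choiceType; classically this is no restriction
   ([boolp.gen_choiceMixin]). *)
HB.mixin Record isLeftSemiBrace B of Group B := {
  bradd : B -> B -> B;
  braddA : associative bradd;
  brmulDr : forall a b c : B, a * bradd b c = bradd (a * b) (a * bradd a^-1 c)
}.

#[short(type="leftSemiBraceType")]
HB.structure Definition LeftSemiBrace := {B of isLeftSemiBrace B & Group B}.

Notation "x + y" := (bradd x y) : brace_scope.
Local Open Scope brace_scope.

(* a + b = a + c -> b = c, which ssrfun calls injectivity on the right. *)
Definition left_cancellative (B : leftSemiBraceType) : Prop :=
  right_injective (@bradd B).

Definition skew_left_brace (B : leftSemiBraceType) : Prop :=
  exists (z : B) (opp : B -> B),
    [/\ left_id z (@bradd B), right_id z (@bradd B),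
        left_inverse z opp (@bradd B) & right_inverse z opp (@bradd B)].

Definition trivial_semibrace (B : leftSemiBraceType) : Prop :=
  forall a b : B, a + b = b.

Section Parts.
Variable B : leftSemiBraceType.

Definition lambda (a b : B) : B := a * (a^-1 + b).

(* G = B + 0, with 0 the neutral element of o *)
Definition skew_part : set B := [set b + 1 | b in [set: B]].

(* E *)
Definition add_idempotents : set B := [set e | e + e = e].

(* Ker(lambda_{|E}) *)
Definition ker_lambdaE : set B :=
  [set a | forall e, add_idempotents e -> lambda a e = e].

End Parts.

Arguments skew_part : clear implicits.
Arguments add_idempotents : clear implicits.
Arguments ker_lambdaE : clear implicits.

Definition isomorphic (B C : leftSemiBraceType) : Prop :=
  exists f : B -> C,
    [/\ bijective f, {morph f : x y / x + y} & {morph f : x y / x * y}].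

(* Homomorphisms (T, o) -> Aut(A, +, o); Aut is a group under composition. *)
Record brace_action (T A : leftSemiBraceType) := BraceAction {
  bract :> T -> A -> A;
  bract_bij : forall c, bijective (bract c);
  bractD : forall c, {morph bract c : x y / x + y};
  bractM : forall c, {morph bract c : x y / x * y};
  bract_comp : forall c d, bract (c * d) =1 bract c \o bract d
}.

(* A copy of A * T indexed by alpha, so that the instances below do not clash
   with those of the plain product. *)
Definition sdprod_brace (A T : leftSemiBraceType) (alpha : brace_action T A)
  : Type := (A * T)%type.

Section Semidirect.
Variables (A T : leftSemiBraceType) (alpha : brace_action T A).
Local Notation S := (sdprod_brace alpha).

Lemma bract_id x : alpha 1 x = x.
Proof.
apply: (bij_inj (bract_bij alpha 1)).
by have := bract_comp alpha 1 1 x; rewrite mulg1.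
Qed.

Lemma bract1 c : alpha c 1 = 1.
Proof. by apply: (mulgI (alpha c 1)); rewrite -bractM !mulg1. Qed.

Lemma bractVK c x : alpha c (alpha c^-1 x) = x.
Proof. by have := bract_comp alpha c c^-1 x; rewrite mulgV bract_id. Qed.

Definition sd_one : S := (1, 1).
Definition sd_mul (x y : S) : S := (x.1 * alpha x.2 y.1, x.2 * y.2).
Definition sd_inv (x : S) : S := (alpha x.2^-1 x.1^-1, x.2^-1).
Definition sd_add (x y : S) : S := (x.1 + y.1, x.2 + y.2).

Lemma sd_mulA : associative sd_mul.
Proof. by move=> x y z; rewrite /sd_mul /= bractM bract_comp !mulgA. Qed.

Lemma sd_mul1 : left_id sd_one sd_mul.
Proof. by case=> a c; rewrite /sd_mul /= bract_id !mul1g. Qed.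

Lemma sd_mulr1 : right_id sd_one sd_mul.
Proof. by case=> a c; rewrite /sd_mul /= bract1 !mulg1. Qed.

Lemma sd_mulV : left_inverse sd_one sd_inv sd_mul.
Proof. by move=> x; rewrite /sd_mul /= -bractM !mulVg bract1. Qed.

Lemma sd_mulrV : right_inverse sd_one sd_inv sd_mul.
Proof. by move=> x; rewrite /sd_mul /= bractVK !mulgV. Qed.

HB.instance Definition _ := Choice.copy S (A * T)%type.
HB.instance Definition _ :=
  isGroup.Build S sd_mulA sd_mul1 sd_mulr1 sd_mulV sd_mulrV.

Lemma sd_addA : associative sd_add.
Proof. by move=> x y z; rewrite /sd_add /= !braddA. Qed.

Lemma sd_mulDr (a b c : S) :
  a * sd_add b c = sd_add (a * b) (a * sd_add a^-1 c).
Proof.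
by congr pair; rewrite /= ?bractD ?bractVK brmulDr.
Qed.

HB.instance Definition _ := isLeftSemiBrace.Build S sd_addA sd_mulDr.

End Semidirect.

(* Main.v *)
(** Write [E] for the idempotents and [G = B + 0].  The group [(B, o)] acts
    through [lambda] on [E], and [lambda e 0 = e] for [e] in [E], so [E] acts
    simply transitively while [G] is the stabiliser of [0].  Hence the kernel of
    the action always lies in [G], and if it equals [G] then [G] is normal with
    complement [E].  In that case [g o e = g + e], and conjugation of [G] by [e]
    is [g |-> lambda e g + 0], which is additive because [0] is a left identity;
    so [B] is the semidirect product of [G] by [E].  Conversely, in [A x| T] the
    elements of [G] have the form [(a, 0)] and the idempotents the form [(0, t)],
    and the former act trivially on the latter. *)
From HB Require Import structures.
Require Import Defs.
From mathcomp Require Import all_boot.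
From mathcomp Require Import classical_sets.

Set Implicit Arguments.
Unset Strict Implicit.
Unset Printing Implicit Defensive.

Local Open Scope group_scope.
Local Open Scope brace_scope.

(** * Subsets closed under the operations, as semi-braces *)

Record sub_semibrace (B : leftSemiBraceType) := SubSemibrace {
  sub_pred :> pred B;
  sub_pred1 : sub_pred 1;
  sub_predM : forall x y, sub_pred x -> sub_pred y -> sub_pred (x * y);
  sub_predV : forall x, sub_pred x -> sub_pred x^-1;
  sub_predD : forall x y, sub_pred x -> sub_pred y -> sub_pred (x + y)
}.

(** Keeping [P] in the type lets the instances below recover the closure proofs. *)
Definition sub_brace (B : leftSemiBraceType) (P : sub_semibrace B) : Type :=
  {x : B | P x}.

Section SubBrace.
Variables (B : leftSemiBraceType) (P : sub_semibrace B).
Local Notation S := (sub_brace P).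

HB.instance Definition _ := SubChoice.copy S {x : B | P x}.

Definition sub_one : S := Sub 1 (sub_pred1 P).
Definition sub_mul (x y : S) : S :=
  Sub (val x * val y) (sub_predM (valP x) (valP y)).
Definition sub_inv (x : S) : S := Sub (val x)^-1 (sub_predV (valP x)).
Definition sub_add (x y : S) : S :=
  Sub (val x + val y) (sub_predD (valP x) (valP y)).

Lemma sub_mulA : associative sub_mul.
Proof. by move=> x y z; apply: val_inj; rewrite /= mulgA. Qed.

Lemma sub_mul1 : left_id sub_one sub_mul.
Proof. by move=> x; apply: val_inj; rewrite /= mul1g. Qed.

Lemma sub_mulr1 : right_id sub_one sub_mul.
Proof. by move=> x; apply: val_inj; rewrite /= mulg1. Qed.

Lemma sub_mulV : left_inverse sub_one sub_inv sub_mul.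
Proof. by move=> x; apply: val_inj; rewrite /= mulVg. Qed.

Lemma sub_mulrV : right_inverse sub_one sub_inv sub_mul.
Proof. by move=> x; apply: val_inj; rewrite /= mulgV. Qed.

HB.instance Definition _ :=
  isGroup.Build S sub_mulA sub_mul1 sub_mulr1 sub_mulV sub_mulrV.

Lemma sub_addA : associative sub_add.
Proof. by move=> x y z; apply: val_inj; rewrite /= braddA. Qed.

Lemma sub_mulDr (a b c : S) :
  a * sub_add b c = sub_add (a * b) (a * sub_add a^-1 c).
Proof. by apply: val_inj; rewrite /= brmulDr. Qed.

HB.instance Definition _ := isLeftSemiBrace.Build S sub_addA sub_mulDr.

Lemma val_subD (x y : S) : val (x + y) = val x + val y. Proof. by []. Qed.

End SubBrace.

Lemma isomorphic_sym (B C : leftSemiBraceType) : isomorphic B C -> isomorphic C B.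
Proof.
case=> f [[g fK gK] fD fM]; exists g; split; first by exists f.
- by move=> x y; apply: (can_inj fK); rewrite fD !gK.
- by move=> x y; apply: (can_inj fK); rewrite fM !gK.
Qed.

(** * The action [lambda] and the sub-semi-braces $E$ and $G$ *)

Section LeftCancellative.
Variables (B : leftSemiBraceType) (hB : left_cancellative B).
Implicit Types a b c e g h x y : B.

(** Distributivity at 1 gives [1 + c = 1 + (1 + c)]; cancel the outer 1. *)
Lemma add1b c : 1 + c = c.
Proof. by have := brmulDr 1 1 c; rewrite invg1 !mul1g => /hB. Qed.

Lemma lambdaD a x y : lambda a (x + y) = lambda a x + lambda a y.
Proof. by rewrite /lambda braddA brmulDr. Qed.

Lemma mul_lambda a b : a * b = a + lambda a b.
Proof. by rewrite -{1}(add1b b) brmulDr mulg1. Qed.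

Lemma lambda1 x : lambda 1 x = x.
Proof. by rewrite /lambda invg1 add1b mul1g. Qed.

Lemma lambdaM a b x : lambda (a * b) x = lambda a (lambda b x).
Proof.
by rewrite /lambda invgM -mulgA; congr (_ * _); rewrite brmulDr mulVKg.
Qed.

Lemma lambdaK a : cancel (lambda a) (lambda a^-1).
Proof. by move=> x; rewrite -lambdaM mulVg lambda1. Qed.

(** Boolean tests, from which subtypes can be formed. The test [g + 1 == g] replaces the existential
    in $B + 0$; the two agree since [1 + 1 = 1]. *)
Definition idem_pred : pred B := fun e => e + e == e.
Definition skew_pred : pred B := fun g => g + 1 == g.

Lemma idem_addl e x : idem_pred e -> e + x = x.
Proof. by move=> /eqP ee; apply: (@hB e); rewrite braddA ee. Qed.

Lemma idem1 : idem_pred 1.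
Proof. by rewrite /idem_pred add1b. Qed.

Lemma idem_lambda a e : idem_pred e -> idem_pred (lambda a e).
Proof. by rewrite /idem_pred -lambdaD => /eqP ->. Qed.

Lemma mul_idem e x : idem_pred e -> e * x = lambda e x.
Proof. by move=> he; rewrite mul_lambda idem_addl. Qed.

Lemma lambda_idem1 e : idem_pred e -> lambda e 1 = e.
Proof. by move=> he; rewrite -mul_idem // mulg1. Qed.

Lemma idemM x y : idem_pred x -> idem_pred y -> idem_pred (x * y).
Proof. by move=> hx hy; rewrite mul_idem // idem_lambda. Qed.

(** [lambda e^-1] sends [lambda e e^-1 = e * e^-1 = 1] to [e^-1], and it preserves idempotents. *)
Lemma idemV e : idem_pred e -> idem_pred e^-1.
Proof.
by move=> he; rewrite -(lambdaK e e^-1) -(mul_idem _ he) mulgV idem_lambda ?idem1.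
Qed.

Lemma idemD x y : idem_pred x -> idem_pred y -> idem_pred (x + y).
Proof. by move=> hx hy; rewrite idem_addl. Qed.

(** Compare [g + 1] with [g = g * 1 = g + lambda g 1] and cancel [g]. *)
Lemma skewP g : reflect (lambda g 1 = 1) (skew_pred g).
Proof.
have eg : g = g + lambda g 1 by rewrite -mul_lambda mulg1.
apply: (iffP eqP) => [g1 | l1]; last by rewrite -[in LHS]l1 -eg.
by apply: (@hB g); rewrite g1 -eg.
Qed.

Lemma skew1 : skew_pred 1.
Proof. by apply/skewP; rewrite lambda1. Qed.

Lemma skewM x y : skew_pred x -> skew_pred y -> skew_pred (x * y).
Proof. by move=> /skewP hx /skewP hy; apply/skewP; rewrite lambdaM hy. Qed.

Lemma skewV x : skew_pred x -> skew_pred x^-1.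
Proof. by move=> /skewP hx; apply/skewP; rewrite -{1}hx lambdaK. Qed.

Lemma skewD x y : skew_pred x -> skew_pred y -> skew_pred (x + y).
Proof. by move=> _ /eqP hy; rewrite /skew_pred -braddA hy. Qed.

Lemma skew_lambda g x : skew_pred g -> skew_pred x -> skew_pred (lambda g x).
Proof. by move=> /skewP g1 /eqP x1; rewrite /skew_pred -[X in _ + X]g1 -lambdaD x1. Qed.

Definition idem_sub : sub_semibrace B := SubSemibrace idem1 idemM idemV idemD.
Definition skew_sub : sub_semibrace B := SubSemibrace skew1 skewM skewV skewD.

Lemma trivial_idem_sub : trivial_semibrace (sub_brace idem_sub).
Proof. by move=> a b; apply: val_inj; exact: idem_addl _ (valP a). Qed.

Lemma skew_skew_sub : skew_left_brace (sub_brace skew_sub).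
Proof.
pose S := sub_brace skew_sub.
(* The opposite is forced by [x + lambda x x^-1 = x * x^-1 = 1]. *)
pose opp (x : S) : S :=
  Sub (lambda (val x) (val x)^-1) (skew_lambda (valP x) (skewV (valP x))).
have add0 : left_id (1 : S) (@bradd S).
  by move=> x; apply: val_inj; rewrite val_subD add1b.
have addr0 : right_id (1 : S) (@bradd S).
  by move=> x; apply: val_inj; rewrite val_subD; apply/eqP/(valP x).
have addrN : right_inverse (1 : S) opp (@bradd S).
  by move=> x; apply: val_inj; rewrite val_subD -mul_lambda mulgV.
exists 1, opp; split => // x.
(* In a monoid where every element has a right inverse, these are two-sided. *)
by rewrite -[LHS]addr0 -{1}(addrN (opp x)) -braddA (braddA x) addrN add0 addrN.
Qed.

Lemma skew_partE g : skew_part B g <-> skew_pred g.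
Proof.
split=> [[b _ <-] | /eqP hg]; last by exists g.
by rewrite /skew_pred -braddA add1b.
Qed.

Lemma ker_sub_skew g : ker_lambdaE B g -> skew_part B g.
Proof. by move=> hg; apply/skew_partE/skewP/hg/eqP/idem1. Qed.

(** * Decomposition of $B$ when $G$ is the kernel *)

Section SkewIsKernel.
Hypothesis skew_ker : skew_part B = ker_lambdaE B.

Lemma skew_fixE g e : skew_pred g -> idem_pred e -> lambda g e = e.
Proof.
move=> /skew_partE hg /eqP he.
by move: hg; rewrite skew_ker; apply.
Qed.

(** The idempotent [lambda e^-1 1] is fixed by [g], so the conjugate acts on 1 as [e * e^-1]
    does. *)
Lemma skew_conj e g : skew_pred g -> skew_pred (e * g * e^-1).
Proof.
move=> hg; apply/skewP.
by rewrite !lambdaM (skew_fixE hg) ?idem_lambda ?idem1 // -lambdaM mulgV lambda1.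
Qed.

Lemma mul_skew_idem g e : skew_pred g -> idem_pred e -> g * e = g + e.
Proof. by move=> hg he; rewrite mul_lambda skew_fixE. Qed.

(** If [c] is the conjugate, then [lambda e g = e * g = c * e = c + e], and
    [c + e + 1 = c + 1 = c]. *)
Lemma conj_lambda e g : idem_pred e -> skew_pred g ->
  e * g * e^-1 = lambda e g + 1.
Proof.
move=> he hg; have hc := skew_conj e hg.
by rewrite -mul_idem // -{2}(mulgVK e (e * g)) (mul_skew_idem hc he) -braddA
           (idem_addl _ he) (eqP hc).
Qed.

Definition conj_act (t : sub_brace idem_sub) (x : sub_brace skew_sub) :
  sub_brace skew_sub := Sub (val t * val x * (val t)^-1) (skew_conj (val t) (valP x)).

Lemma conj_act_comp s t : conj_act (s * t) =1 conj_act s \o conj_act t.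
Proof. by move=> x; apply: val_inj; rewrite /= invgM !mulgA. Qed.

Lemma conj_act_id : conj_act 1 =1 id.
Proof. by move=> x; apply: val_inj; rewrite /= invg1 mulg1 mul1g. Qed.

Lemma conj_act_bij t : bijective (conj_act t).
Proof.
exists (conj_act t^-1) => x.
- by have := conj_act_comp t^-1 t x; rewrite mulVg conj_act_id.
- by have := conj_act_comp t t^-1 x; rewrite mulgV conj_act_id.
Qed.

Lemma conj_actD t : {morph conj_act t : u v / u + v}.
Proof.
case: t => e he [g hg] [h hh]; apply: val_inj.
by rewrite /= !conj_lambda ?skewD // lambdaD -!braddA (braddA 1) add1b.
Qed.

Lemma conj_actM t : {morph conj_act t : u v / u * v}.
Proof. by move=> x y; apply: val_inj; rewrite /= !mulgA mulgVK. Qed.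

Definition conj_action : brace_action (sub_brace idem_sub) (sub_brace skew_sub) :=
  BraceAction conj_act_bij conj_actD conj_actM conj_act_comp.

(** With [e = lambda b 1], the element [e^-1 * b] fixes 1, and [b * e^-1] is its conjugate by
    [e]. *)
Lemma idem_complement b : skew_pred (b * (lambda b 1)^-1).
Proof.
set e := lambda b 1; have he : idem_pred e by apply/idem_lambda/idem1.
have hg : skew_pred (e^-1 * b).
  by apply/skewP; rewrite lambdaM -/e -[RHS](lambdaK e) lambda_idem1.
by have := skew_conj e hg; rewrite mulVKg.
Qed.

Lemma isomorphic_conj_sdprod : isomorphic (sdprod_brace conj_action) B.
Proof.
exists (fun p => val p.1 * val p.2); split.
- exists (fun b => (Sub _ (idem_complement b), Sub _ (idem_lambda b idem1))).
    case=> -[g hg] [e he] /=.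
    (* The factor in $E$ is recovered as the image of 1. *)
    have l1 : lambda (g * e) 1 = e by rewrite lambdaM lambda_idem1 // skew_fixE.
    by congr pair; apply: val_inj; rewrite /= l1 ?mulgK.
  by move=> b; rewrite /= mulgVK.
- case=> -[g hg] [e he] [[h hh] [f hf]] /=.
  (* Both sides become [g + h + f], as [e] is a left identity for [+]. *)
  rewrite !mul_skew_idem ?skewD ?idemD //.
  by rewrite (idem_addl f he) -!braddA (idem_addl _ he).
- case=> -[g hg] [e he] [[h hh] [f hf]] /=.
  by rewrite !mulgA mulgVK.
Qed.

End SkewIsKernel.
End LeftCancellative.

(** * Semidirect products and the converse *)

Lemma skew_left_brace_zero (A : leftSemiBraceType) (z : A) :
  left_id z (@bradd A) -> right_id z (@bradd A) -> z = 1.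
Proof.
(* This instance reads [z + z = z + (1 + z)], whose sides are [z] and 1. *)
move=> add0 addr0; have := brmulDr 1 z z.
by rewrite invg1 !mul1g addr0 add0 addr0.
Qed.

Lemma sdprod_skew_fix (A T : leftSemiBraceType) (alpha : brace_action T A)
    (x e : sdprod_brace alpha) :
  skew_left_brace A -> trivial_semibrace T ->
  skew_part _ x -> add_idempotents _ e -> lambda x e = e.
Proof.
case=> z [opp [add0 addr0 addN _]] triv [[b t] _ <-].
have z1 := skew_left_brace_zero add0 addr0; subst z.
case: e => u v [uu _].
(* An idempotent of an additive group is its zero. *)
have {uu} -> : u = 1 by rewrite -[LHS]add0 -(addN u) -braddA uu.
(* As [x] equals [(b, 1)], the components are [b * b^-1 = 1] and [1 * v = v]. *)
congr pair; rewrite /= triv; last by rewrite triv mul1g.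
by rewrite !addr0 bractVK mulgV.
Qed.

Theorem theorem3p3 (B : leftSemiBraceType) (hB : left_cancellative B) :
  skew_part B = ker_lambdaE B <->
  exists (A T : leftSemiBraceType) (alpha : brace_action T A),
    [/\ skew_left_brace A, trivial_semibrace T
      & isomorphic B (sdprod_brace alpha)].
Proof.
split=> [skew_ker | [A [T [alpha [skA trT [f [bijf fD fM]]]]]]].
  exists (sub_brace (skew_sub hB)), (sub_brace (idem_sub hB)).
  exists (conj_action hB skew_ker); split.
  - exact: skew_skew_sub.
  - exact: trivial_idem_sub.
  - exact/isomorphic_sym/isomorphic_conj_sdprod.
(* Preserving 1 and inverses, [f] commutes with [lambda] and maps $G$ and $E$ into their
   counterparts. *)
have f1 : f 1 = 1 by apply: (mulgI (f 1)); rewrite -fM !mulg1.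
have fV a : f a^-1 = (f a)^-1 by apply: (mulgI (f a)); rewrite -fM !mulgV.
apply/seteqP; split=> [x [b _ <-] e he | x]; last exact: ker_sub_skew.
apply: (bij_inj bijf); rewrite fM (fD _ e) fV.
apply: sdprod_skew_fix => //; last by rewrite /add_idempotents /= -fD he.
by exists (f b); rewrite // fD f1.
Qed.
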